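(* Let $I\subset R=\mathbf{k}[x_1,\dots,x_n]$ be a monomial ideal and $\hat I$ its artinian closure; let $\mathcal{B}_{n-1}(\hat I)$ be the set of multidegrees $\nu\in\mathbb{N}^n$ such that $H_{n-1,\nu}(\mathbb{K}(\hat I))\neq 0$. Then the irredundant irreducible decomposition of $I$ is $$I=\bigcap_{\nu\in\mathcal{B}_{n-1}(\hat I)}\mathfrak{m}^{\underline{\nu}},$$ where $\underline{\nu}_i=0$ if $x_i$ belongs to some $C\in TF(x^\nu)$, and $\underline{\nu}_i=\nu_i$ otherwise. Here $TF(x^\nu)$ is the set of cones of true free directions of $x^\nu$ with respect to $I$.
   Context: $\mathbf{k}$ is a field of characteristic $0$, $R=\mathbf{k}[x_1,\dots,x_n]$ with its $\mathbb{N}^n$-grading; monomial ideals are taken nonzero and proper. For $\nu\in\mathbb{N}^n$, $\mathfrak{m}^{\nu}=\langle x_i^{\nu_i}\mid \nu_i>0\rangle$. Artinian closure: let $x^\lambda$ be the least common multiple of all the minimal generators of $I$; then $\hat I=I+\langle x_1^{\lambda_1+1},\dots,x_n^{\lambda_n+1}\rangle$. True free directions: for $\nu\in\mathbb{N}^n$ let $\nu'$ be obtained by subtracting $1$ from each nonzero coordinate of $\nu$. For a monomial $x^\nu$, a set of variables $\{x_{j_1},\dots,x_{j_k}\}$ is a cone of true free directions of $x^\nu$ with respect to $I$ if $x^{\nu'}\cdot x^{\sigma}\notin I$ for every monomial $x^\sigma\in\mathbf{k}[x_{j_1},\dots,x_{j_k}]$. $TF(x^\nu)$ denotes the set of all cones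 of true free directions of $x^\nu$ (with respect to $I$). An irreducible decomposition of a monomial ideal is an expression of it as a finite intersection of ideals of the form $\mathfrak{m}^{a}$; it is irredundant if no intersectand can be omitted. The irredundant irreducible decomposition is unique. Koszul homology: let $\mathcal{V}$ be the $\mathbf{k}$-vector space with basis $x_1,\dots,x_n$. For a monomial ideal $J$, $\mathbb{K}(J)$ is the complex with modules $J\otimes_{\mathbf{k}}\wedge^i\mathcal{V}$ and differential $\partial(m\otimes x_{j_1}\wedge\cdots\wedge x_{j_i})=\sum_{l=1}^i(-1)^{l+1}x_{j_l}m\otimes x_{j_1}\wedge\cdots\wedge\widehat{x_{j_l}}\wedge\cdots\wedge x_{j_i}$. It is $\mathbb{N}^n$-graded (the multidegree of $x^\mu\otimes x_{j_1}\wedge\cdots\wedge x_{j_i}$ is $\mu+e_{j_1}+\cdots+e_{j_i}$), and $H_{i,\nu}(\mathbb{K}(J))\cong \mathrm{Tor}^R_{i,\nu}(J,\mathbf{k})$ is the multidegree-$\nu$ part of its $i$-th homology. *)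

(* Defs.v *)
(* Multinomials provide k[x_1,...,x_n]; the classical layer (boolp,
   classical_sets, cardinality) provides sets of polynomials and multidegrees. *)
From HB Require Import structures.
From mathcomp Require Import all_boot all_order all_algebra.
From mathcomp Require Import boolp classical_sets cardinality.
From mathcomp Require Import mpoly.

Set Implicit Arguments.
Unset Strict Implicit.
Unset Printing Implicit Defensive.

Import GRing.Theory.
Local Open Scope classical_set_scope.
Local Open Scope ring_scope.

Section Ideals.
Context {n : nat} {K : fieldType}.
Local Notation R := {mpoly K[n]}.

Definition is_ideal (J : set R) : Prop :=
  [/\ J 0, forall p q, J p -> J q -> J (p + q) & forall a p, J p -> J (a * p)].

Definition ideal_gen (G : set R) : set R := smallest is_ideal G.

Definition monomials (A : set 'X_{1..n}) : set R := [set 'X_[m] | m in A].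

(* Monomial ideals are nonzero and proper by convention; the generating set is
   arbitrary, so that finite generation is not built in. In particular there is
   no monomial ideal when n = 0. *)
Definition monomial_ideal (I : set R) : Prop :=
  [/\ exists A, I = ideal_gen (monomials A), I <> [set 0] & I <> [set: R]].

(* The ideal m^a; it is [set 0] for a = 0. *)
Definition mpow (a : 'X_{1..n}) : set R :=
  ideal_gen [set 'X_i ^+ a i | i in [set i | (0 < a i)%N]].

Definition minimal_generator (I : set R) (m : 'X_{1..n}) : Prop :=
  I 'X_[m] /\ forall m' : 'X_{1..n}, I 'X_[m'] -> (m' <= m)%MM -> m' = m.

(* Pointwise order on exponents is divisibility of monomials, so this says that
   'X_[l] is the least common multiple of the minimal generators. *)
Definition lcm_generators (I : set R) (l : 'X_{1..n}) : Prop :=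
  (forall m, minimal_generator I m -> (m <= l)%MM) /\
  (forall l', (forall m, minimal_generator I m -> (m <= l')%MM) ->
    (l <= l')%MM).

(* There is at most one l with lcm_generators I l, so the set on the right
   consists of the n powers 'X_i ^+ (l i).+1 for that l. *)
Definition artinian_closure (I : set R) : set R :=
  ideal_gen (I `|`
    [set p | exists l i, lcm_generators I l /\ p = 'X_i ^+ (l i).+1]).

Definition mnm_prime (nu : 'X_{1..n}) : 'X_{1..n} :=
  [multinom (nu i).-1 | i < n].

(* The set of variables {x_j | j in C} is a cone of true free directions of
   'X_[nu], i.e. C belongs to TF(x^nu), with respect to I. *)
Definition true_free_cone (I : set R) (nu : 'X_{1..n}) (C : {set 'I_n}) : Prop :=
  forall s : 'X_{1..n}, (forall i, i \notin C -> s i = 0%N) ->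
    ~ I ('X_[mnm_prime nu] * 'X_[s]).

Definition underline (I : set R) (nu : 'X_{1..n}) : 'X_{1..n} :=
  [multinom if `[< exists C, true_free_cone I nu C /\ i \in C >] then 0%N
            else nu i | i < n].

(* An indexed family of ideals m^(a nu), nu in B; omitting the intersectand at
   a single index must change the intersection, so in particular distinct
   indices give distinct intersectands. *)
Definition irredundant_irreducible_decomposition
    (I : set R) (B : set 'X_{1..n}) (a : 'X_{1..n} -> 'X_{1..n}) : Prop :=
  [/\ finite_set B,
      I = \bigcap_(nu in B) mpow (a nu)
    & forall nu0, B nu0 -> I <> \bigcap_(nu in B `\ nu0) mpow (a nu)].

End Ideals.

Section Koszul.
Context {n : nat} {K : fieldType}.
Local Notation R := {mpoly K[n]}.

(* f : koszul_module stands for the sum over S = {j_1 < ... < j_i} of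
   f S * (x_{j_1} ^ ... ^ x_{j_i}), an element of R tensored with the exterior
   algebra of V; the part in J tensored with the i-th exterior power is cut out by koszul_chain. *)
Definition koszul_module := {ffun {set 'I_n} -> R}.

Definition koszul_chain (J : set R) (i : nat) (f : koszul_module) : Prop :=
  forall S : {set 'I_n}, if #|S| == i then J (f S) else f S = 0.

Definition koszul_homogeneous (nu : 'X_{1..n}) (f : koszul_module) : Prop :=
  forall (S : {set 'I_n}) (m : 'X_{1..n}), m \in msupp (f S) ->
    forall j : 'I_n, nu j = (m j + (j \in S))%N.

(* Coefficient of d f at T: the terms contributing are the S = T + {j} with j
   not in T, and if j is the l-th smallest element of S then the number of
   t in T with t < j is l - 1, so the sign is (-1)^(l-1) = (-1)^(l+1). *)
Definition koszul_diff (f : koszul_module) : koszul_module :=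
  [ffun T : {set 'I_n} => \sum_(j : 'I_n | j \notin T)
     (-1) ^+ #|[pred t in T | (t < j)%N]| * ('X_j * f (j |: T)%SET)].

Definition koszul_cycles (J : set R) (i : nat) (nu : 'X_{1..n}) :
    set koszul_module :=
  [set f | [/\ koszul_chain J i f, koszul_homogeneous nu f
             & koszul_diff f = 0]].

Definition koszul_boundaries (J : set R) (i : nat) (nu : 'X_{1..n}) :
    set koszul_module :=
  [set koszul_diff g | g in [set g | koszul_chain J i.+1 g
                                   /\ koszul_homogeneous nu g]].

(* H_{i,nu}(K(J)) <> 0: the quotient cycles / boundaries is not zero. *)
Definition koszul_homology_neq0 (J : set R) (i : nat) (nu : 'X_{1..n}) : Prop :=
  exists2 z, koszul_cycles J i nu z & ~ koszul_boundaries J i nu z.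

Definition koszul_multidegrees (J : set R) (i : nat) : set 'X_{1..n} :=
  [set nu | koszul_homology_neq0 J i nu].

End Koszul.

(* Main.v *)
Require Import Defs.
From HB Require Import structures.
From mathcomp Require Import all_boot all_order all_algebra.
From mathcomp Require Import boolp classical_sets cardinality.
From mathcomp Require Import mpoly.
From mathcomp Require Import zify.

Set Implicit Arguments.
Unset Strict Implicit.
Unset Printing Implicit Defensive.

Import GRing.Theory.

(** Everything is read off the up-closed set U of exponents of monomials in I.
    Let l be the exponent of the lcm of the minimal generators, which exists by
    Dickson's lemma; the monomials of the artinian closure have exponents in
    V = U plus all exponents exceeding l in some coordinate. Call s a corner of
    V if s is not in V but every s + e_i is.

    Koszul homology sees exactly the corners
    ([koszul_multidegrees_corner]): a cycle z in homological degree n - 1 and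
    multidegree nu is determined by any one of its n components, because the
    cycle equation at the complement of {i, j} reads x_i z_j = +- x_j z_i. Hence
    z is the differential of a multiple c x^s of the top exterior product, with
    s = nu - 1. It lies in the complex of the closure when all s + e_i do, and
    it is a boundary there when s does; so homology is nonzero exactly
    when s is a corner of V.

    For a corner s, raising coordinate i never leads into I if and only if
    s_i = l_i ([mpow_underline]): if s_i < l_i then s + e_i is still bounded by
    l, so it lies in V only by lying in U; if s_i = l_i, a minimal generator
    dividing x^s x_i^k already divides x^s. So the ideal attached to nu = s + 1
    is spanned by the monomials with s_i < m_i at some i with s_i < l_i.

    The decomposition is then combinatorial. If m is in U, a minimal generator
    below m exceeds s at some i, and is itself at most l there. If m is not in
    U, then min(m, l) is not in V and a corner above it gives an ideal missing
    m ([up_closed_components]). Corners form a finite antichain, and x^s lies in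
    the ideals of all corners other than s ([component_other]) but not in I,
    which gives irredundancy. *)

(** * Combinatorics of up-closed sets of exponents *)
Section Exponents.
Context {n : nat}.
Local Open Scope classical_set_scope.

Definition up_closed (U : set 'X_{1..n}) : Prop :=
  forall m m', U m -> (m <= m')%MM -> U m'.

Definition minimal_exponent (U : set 'X_{1..n}) (m : 'X_{1..n}) : Prop :=
  U m /\ forall m', U m' -> (m' <= m)%MM -> m' = m.

(** Dickson's lemma, by induction on the number [k] of coordinates compared:
    the induction needs bases for the slices of [U], where only the first [k]
    coordinates remain relevant. *)
Lemma dickson_prefix (k : nat) (U : set 'X_{1..n}) :
  exists s : seq 'X_{1..n}, (forall b, b \in s -> U b) /\
    forall a, U a -> exists2 b, b \in s &
      forall i : 'I_n, (i < k)%N -> (b i <= a i)%N.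
Proof.
elim: k U => [|k IHk] U.
  have [[a Ua]|U0] := pselect (exists a, U a).
    by exists [:: a]; split=> [b|b _]; [rewrite inE => /eqP-> | exists a; rewrite ?inE].
  by exists [::]; split=> // a Ua; case: U0; exists a.
have [ltkn|lenk] := ltnP k n; last first.
  have [s [sU sP]] := IHk U; exists s; split=> // a /sP[b bs ba].
  by exists b => // i _; apply/ba/(leq_trans (ltn_ord i)).
pose o := Ordinal ltkn.
have [s [sU sP]] := IHk U.
pose N := \max_(b <- s) b o.
(* An exponent whose k-th coordinate is at least N is handled by s itself; the
   remaining ones fall into the N slices below, one for each value. *)
have slices M : exists t : seq 'X_{1..n}, (forall b, b \in t -> U b) /\
    forall a, U a -> (a o < M)%N -> exists2 b, b \in t &
      forall i : 'I_n, (i < k.+1)%N -> (b i <= a i)%N.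
  elim: M => [|M [t [tU tP]]]; first by exists [::].
  have [u [uU uP]] := IHk [set a | U a /\ a o = M].
  exists (t ++ u); split=> [b|a Ua].
    by rewrite mem_cat => /orP[/tU//|/uU[]].
  rewrite ltnS leq_eqVlt => /predU1P[aM|/(tP _ Ua)[b bt ba]]; last first.
    by exists b; rewrite // mem_cat bt.
  have [//|b bu ba] := uP a; exists b; first by rewrite mem_cat bu orbT.
  move=> i; rewrite ltnS leq_eqVlt => /predU1P[ik|/ba//].
  by have -> : i = o; [apply: val_inj | rewrite aM; have [_ ->] := uU _ bu].
have [t [tU tP]] := slices N.
exists (s ++ t); split=> [b|a Ua]; first by rewrite mem_cat => /orP[/sU|/tU].
have [ltaN|leNa] := ltnP (a o) N.
  by have [b bt ba] := tP a Ua ltaN; exists b; rewrite // mem_cat bt orbT.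
have [b bs ba] := sP a Ua; exists b; first by rewrite mem_cat bs.
move=> i; rewrite ltnS leq_eqVlt => /predU1P[ik|/ba//].
have -> : i = o by apply: val_inj.
exact: leq_trans (leq_bigmax_seq _ bs isT) leNa.
Qed.

Lemma dickson (U : set 'X_{1..n}) :
  exists s : seq 'X_{1..n}, forall m, minimal_exponent U m -> m \in s.
Proof.
have [s [sU sP]] := dickson_prefix n U.
exists s => m [Um mmin]; have [b bs bm] := sP m Um.
by rewrite -(mmin b (sU b bs)) //; apply/mnm_lepP => i; apply: bm.
Qed.

Lemma minimal_exponent_below (U : set 'X_{1..n}) m :
  U m -> exists2 g, minimal_exponent U g & (g <= m)%MM.
Proof.
have [d] := ubnP (mdeg m); elim: d m => // d IHd m ledm Um.
have [mmin|] := pselect (minimal_exponent U m); first by exists m; rewrite ?lepm_refl.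
move=> /not_andP[//|/existsNP[m' /not_implyP[Um' /not_implyP[lem' /eqP ne]]]].
have [|g gmin leg] := IHd m' _ Um'; last by exists g => //; apply: lepm_trans lem'.
rewrite -ltnS; apply: leq_trans ledm; rewrite ltnS -(submK lem') mdegD.
rewrite -[ltnLHS]add0n ltn_add2r lt0n mdeg_eq0; apply: contraNneq ne => e.
by rewrite -[X in _ == X](submK lem') e add0m.
Qed.

Definition exponent_lcm (U : set 'X_{1..n}) (l : 'X_{1..n}) : Prop :=
  (forall m, minimal_exponent U m -> (m <= l)%MM) /\
  (forall l', (forall m, minimal_exponent U m -> (m <= l')%MM) -> (l <= l')%MM).

Lemma exponent_lcm_exists (U : set 'X_{1..n}) : exists l, exponent_lcm U l.
Proof.
have [s sP] := dickson U.
exists [multinom \max_(m <- s | `[< minimal_exponent U m >]) m i | i < n].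
split=> [m mmin|l' l'P]; apply/mnm_lepP => i; rewrite mnmE.
  by apply: leq_bigmax_seq; [apply: sP | apply/asboolP].
by apply/bigmax_leqP_seq => m _ /asboolP/l'P/mnm_lepP.
Qed.

Definition corner (V : set 'X_{1..n}) (s : 'X_{1..n}) : Prop :=
  ~ V s /\ forall i, V (s + U_(i))%MM.

(** If s <= t differ at i, then s + e_i <= t, which would put t in V. *)
Lemma corner_antichain (V : set 'X_{1..n}) s t :
  up_closed V -> corner V s -> corner V t -> (s <= t)%MM -> s = t.
Proof.
move=> upV [_ sV] [tV _] /mnm_lepP lest; apply/mnmP => i; apply/eqP.
rewrite eqn_leq lest leqNgt; apply/negP => lti; apply/tV/(upV _ _ (sV i)).
apply/mnm_lepP => j; rewrite mnmDE mnm1E.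
by have [<-|_] := eqVneq i j; rewrite ?addn1 ?addn0.
Qed.

(** Exponents outside [V] are bounded by [l], so raising coordinates one at a
    time as long as the result stays outside [V] must stop, at a corner. *)
Lemma corner_above (V : set 'X_{1..n}) (l : 'X_{1..n}) m :
  (forall (m' : 'X_{1..n}) i, (l i < m' i)%N -> V m') -> ~ V m ->
  exists2 s, corner V s & (m <= s)%MM.
Proof.
move=> bndV; have le_l m' : ~ V m' -> (m' <= l)%MM.
  move=> Vm'; apply/mnm_lepP => i; rewrite leqNgt; apply/negP.
  by move=> /bndV.
have [d] := ubnP (mdeg l - mdeg m)%N; elim: d m => // d IHd m led Vm.
have [|/existsNP[i Vi]] := pselect (forall i, V (m + U_(i))%MM).
  by exists m; rewrite ?lepm_refl.
have [|s cs les] := IHd (m + U_(i))%MM _ Vi; last first.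
  by exists s => //; apply: lepm_trans les; apply: lem_addr.
have := submK (le_l _ Vi); move/(congr1 mdeg); rewrite !mdegD mdeg1.
by move: led; lia.
Qed.
Definition exceeds (l : 'X_{1..n}) : set 'X_{1..n} :=
  [set m | exists i, (l i < m i)%N].

(** The exponents of the irreducible ideal generated by the powers
    x_i^(s_i + 1) with s_i < l_i. *)
Definition component (l s : 'X_{1..n}) : set 'X_{1..n} :=
  [set m : 'X_{1..n} | exists i, (s i < l i)%N && (s i < m i)%N].

Lemma up_closed_exceeds (U : set 'X_{1..n}) l :
  up_closed U -> up_closed (U `|` exceeds l).
Proof.
move=> upU m m' [Um|[i lti]] mm'; first by left; apply: upU mm'.
by right; exists i; apply: leq_trans lti (mnm_lepP mm' i).
Qed.

(** A minimal exponent below m exceeds s in some coordinate, and there it is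
    itself bounded by l. Conversely the corner rejecting an m outside U is found
    above min(m, l): truncating at l is harmless since m only has to be
    compared with s in the coordinates where s_i < l_i. *)
Lemma up_closed_components (U : set 'X_{1..n}) l m :
  up_closed U -> exponent_lcm U l ->
  U m <-> forall s, corner (U `|` exceeds l) s -> component l s m.
Proof.
move=> upU [ub _]; split=> [Um s [/not_orP[nUs _] _]|comps].
  have [g gmin /mnm_lepP leg] := minimal_exponent_below Um.
  have [i lti] : exists i, (s i < g i)%N.
    apply: contrapT => /forallNP nlt; apply/nUs/(upU _ _ gmin.1)/mnm_lepP => i.
    by rewrite leqNgt; apply/negP.
  exists i; rewrite (leq_trans lti (leg i)) andbT.
  exact: leq_trans lti (mnm_lepP (ub _ gmin) i).
apply: contrapT => nUm.
pose m' : 'X_{1..n} := [multinom minn (m i) (l i) | i < n].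
have Um' : ~ (U `|` exceeds l) m'.
  case=> [Um'|[i]]; last by rewrite mnmE ltnNge geq_minr.
  by apply/nUm/(upU _ _ Um')/mnm_lepP => i; rewrite mnmE geq_minl.
have [s cs /mnm_lepP les] := corner_above (fun _ i h => or_intror (ex_intro _ i h)) Um'.
have [i /andP[lt1 lt2]] := comps s cs.
by have := les i; rewrite mnmE leqNgt leq_min lt1 lt2.
Qed.

(** By the antichain property s exceeds t at some i, and s <= l because
    [s] is a corner; hence t_i < s_i <= l_i. *)
Lemma component_other (U : set 'X_{1..n}) l s t : up_closed U ->
  corner (U `|` exceeds l) s -> corner (U `|` exceeds l) t -> t <> s ->
  component l t s.
Proof.
move=> upU cs ct nts; apply: contrapT => /forallNP nlt; apply: nts; apply/esym.
apply: (corner_antichain _ cs ct); first exact: up_closed_exceeds.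
apply/mnm_lepP => i; rewrite leqNgt; apply/negP => lti; apply: (nlt i).
rewrite lti andbT; apply: leq_trans lti _; rewrite leqNgt; apply/negP => ltl.
by case: cs => -[]; right; exists i.
Qed.

Lemma finite_corners (U : set 'X_{1..n}) l :
  finite_set (corner (U `|` exceeds l)).
Proof.
apply: (@sub_finite_set _ _ [set val b | b in [set: 'X_{1..n < (mdeg l).+1}]]).
  move=> s [/not_orP[_ /forallNP nls] _].
  have les : (mdeg s < (mdeg l).+1)%N.
    rewrite ltnS !mdegE; apply: leq_sum => i _; rewrite leqNgt.
    exact/negP/nls.
  by exists (BMultinom les).
exact/finite_image/finite_finset.
Qed.
End Exponents.

(** * Monomial ideals as spans of up-closed sets *)
Section Spans.
Context {n : nat} {K : fieldType}.
Local Open Scope classical_set_scope.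
Local Open Scope ring_scope.
Local Notation R := {mpoly K[n]}.
Implicit Types (U V : set 'X_{1..n}) (p q : R) (m : 'X_{1..n}).

Definition monomial_span U : set R :=
  [set p : R | forall m, m \in msupp p -> U m].

Lemma monomial_span_X U m : monomial_span U 'X_[m] <-> U m.
Proof.
by split=> [|Um m' /mem_msuppXP<-//]; apply; apply/mem_msuppXP.
Qed.

Lemma monomial_span_ideal U : up_closed U -> is_ideal (monomial_span U).
Proof.
move=> upU; split=> [m|p q Up Uq m|a p Up m].
- by rewrite msupp0.
- by move=> /msuppD_le; rewrite mem_cat => /orP[/Up|/Uq].
- case/msuppM_le/allpairsP => -[m1 m2] /= [_ /Up Um2 ->].
  exact: upU Um2 (lem_addl _ _).
Qed.

Lemma ideal_genP (G : set R) : is_ideal (ideal_gen G).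
Proof.
split=> [A [[]]//|p q Gp Gq A AG|a p Gp A AG].
- by case: (AG) => -[_ AD _] _; apply: AD; [exact: (Gp A) | exact: (Gq A)].
- by case: (AG) => -[_ _ AM] _; apply/AM/(Gp A).
Qed.

Lemma ideal_gen_sub (G : set R) p : G p -> ideal_gen G p.
Proof. exact: sub_gen_smallest. Qed.

Lemma ideal_multiple (J : set R) m m' :
  is_ideal J -> J 'X_[m] -> (m <= m')%MM -> J 'X_[m'].
Proof. by move=> [_ _ JM] Jm /submK <-; rewrite mpolyXD; apply: JM. Qed.

Lemma ideal_gen_span (G : set R) U :
  up_closed U -> (forall p, G p -> monomial_span U p) ->
  (forall m, U m -> ideal_gen G 'X_[m]) -> ideal_gen G = monomial_span U.
Proof.
move=> upU GU UG; apply/seteqP; split=> [|p Up].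
  by apply: smallest_sub => //; apply: monomial_span_ideal.
have [J0 JD JM] := ideal_genP G.
rewrite [p]mpolyE big_seq; elim/big_ind: _ => // m /Up/UG.
by rewrite -mul_mpolyC; apply: JM.
Qed.

Lemma monomial_ideal_span (I : set R) : monomial_ideal I ->
  exists U, [/\ up_closed U, I = monomial_span U, ~ U 0%MM & exists m, U m].
Proof.
move=> [[A ->] nz nT]; pose U := [set m | exists2 a, A a & (a <= m)%MM].
have upU : up_closed U.
  by move=> m m' [a Aa am] mm'; exists a => //; apply: lepm_trans mm'.
have spanU : ideal_gen (monomials A) = monomial_span U.
  apply: ideal_gen_span => // [_ [a Aa <-]|m [a Aa am]].
    by apply/monomial_span_X; exists a; rewrite ?lepm_refl.
  apply: ideal_multiple am; first exact: ideal_genP.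
  by apply: ideal_gen_sub; exists a.
exists U; split=> // [U0|].
  apply: nT; rewrite spanU; apply/seteqP; split=> // p _ m _.
  by apply: upU U0 _; apply/mnm_lepP => i; rewrite mnm0E.
apply: contrapT => /forallNP nU; apply: nz; rewrite spanU.
apply/seteqP; split=> [p Up|_ -> m]; last by rewrite msupp0.
apply: msuppnil0; case e : (msupp p) => [//|m s].
by case: (nU m); apply: Up; rewrite e mem_head.
Qed.

Lemma minimal_generatorE U m :
  minimal_generator (monomial_span U) m <-> minimal_exponent U m.
Proof.
split=> -[/monomial_span_X Um mmin]; split=> //.
  by move=> m' Um'; apply: mmin; apply/monomial_span_X.
by move=> m' /monomial_span_X; apply: mmin.
Qed.

Lemma lcm_generatorsE U l :
  lcm_generators (monomial_span U) l <-> exponent_lcm U l.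
Proof.
split=> -[ub lub]; split=> [m /minimal_generatorE/ub//|l' ub'].
  by apply: lub => m /minimal_generatorE/ub'.
by apply: lub => m /minimal_generatorE/ub'.
Qed.

Lemma mulmn1_lep k i m : ((U_(i) *+ k)%MM <= m)%MM = (k <= m i)%N.
Proof.
apply/mnm_lepP/idP => [/(_ i)|le j]; rewrite mulmnE mnm1E ?eqxx ?mul1n //.
by case: eqVneq => [<-|_]; rewrite ?mul1n ?mul0n.
Qed.

Lemma artinian_closure_span U l : up_closed U -> exponent_lcm U l ->
  artinian_closure (monomial_span U) = monomial_span (U `|` exceeds l).
Proof.
move=> upU lcml; apply: ideal_gen_span.
- exact: up_closed_exceeds.
- move=> p [Up m /Up Um|]; first by left.
  move=> [l' [i [/lcm_generatorsE lcml' ->]]].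
  rewrite mpolyXn; apply/monomial_span_X; right; exists i.
  rewrite mulmnE mnm1E eqxx mul1n ltnS.
  have [[ub _] [_ lub]] := (lcml', lcml).
  exact: (mnm_lepP (lub _ ub)).
- move=> m [Um|[i lti]].
    by apply: ideal_gen_sub; left; apply/monomial_span_X.
  have ideal_m := @ideal_genP (monomial_span U `|`
    [set p | exists l i, lcm_generators (monomial_span U) l /\ p = 'X_i ^+ (l i).+1]).
  apply: (ideal_multiple (m := (U_(i) *+ (l i).+1)%MM)) => //.
    apply: ideal_gen_sub; right; exists l, i; rewrite mpolyXn.
    by split=> //; apply/lcm_generatorsE.
  by rewrite mulmn1_lep.
Qed.

Lemma mpow_span (a : 'X_{1..n}) :
  mpow a = monomial_span [set m | exists i, (0 < a i <= m i)%N] :> set R.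
Proof.
apply: ideal_gen_span.
- move=> m m' [i /andP[a0 am]] mm'; exists i; rewrite a0.
  exact: leq_trans am (mnm_lepP mm' i).
- move=> _ [i /= a0 <-]; rewrite mpolyXn; apply/monomial_span_X; exists i.
  by rewrite a0 mulmnE mnm1E eqxx mul1n leqnn.
- move=> m [i /andP[a0 am]].
  apply: (ideal_multiple (m := (U_(i) *+ a i)%MM)); first exact: ideal_genP.
    by apply: ideal_gen_sub; exists i; rewrite // mpolyXn.
  by rewrite mulmn1_lep.
Qed.

End Spans.

(** * Koszul homology in homological degree n - 1 *)
Section Koszul.
Context {n : nat} {K : fieldType}.
Local Open Scope classical_set_scope.
Local Open Scope ring_scope.
Local Notation R := {mpoly K[n]}.
Local Notation chain := {ffun {set 'I_n} -> R}.
Implicit Types (f g z : chain) (S T : {set 'I_n}) (nu : 'X_{1..n}).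

(** The terms for an ordered pair (j, k) and for (k, j) involve the same
    coefficient of [f], with opposite signs. *)
Lemma koszul_diff_sq0 f : koszul_diff (koszul_diff f) = 0.
Proof.
apply/ffunP => T; rewrite !ffunE.
pose s (j : 'I_n) := #|[pred t in T | (t < j)%N]|.
pose F (j k : 'I_n) : R :=
  (-1) ^+ s j * ((-1) ^+ s k * ('X_j * ('X_k * f (k |: (j |: T))%SET))).
have FC j k : F j k = F k j.
  by rewrite /F finset.setUCA mulrCA; do 2!congr (_ * _); rewrite mulrCA.
have term (j : 'I_n) : j \notin T ->
    (-1) ^+ s j * ('X_j * koszul_diff f (j |: T)%SET) =
    \sum_(k | (k \notin T) && (k < j)%N) F j k
      - \sum_(k | (k \notin T) && (j < k)%N) F j k.
  move=> jT; rewrite ffunE mulr_sumr mulr_sumr (bigID (fun k : 'I_n => (k < j)%N)) /=.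
  (* The position of k in j |: T is shifted by one exactly when j < k. *)
  have sgn (k : 'I_n) : #|[pred t in (j |: T)%SET | (t < k)%N]| = ((j < k) + s k)%N.
    rewrite (cardD1 j) !inE eqxx /=; congr (_ + _)%N; apply: eq_card => t.
    by rewrite !inE; case: eqVneq => [->|]; rewrite ?(negPf jT).
  rewrite -sumrN; congr (_ + _); apply: eq_big => [k|k].
  - by rewrite !inE -val_eqE /=; case: ltngtP; rewrite ?andbF ?andbT.
  - move=> /andP[_ ltkj].
    by rewrite sgn ltnNge (ltnW ltkj) add0n /F; congr (_ * _); rewrite mulrCA.
  - by rewrite !inE -val_eqE /=; case: ltngtP; rewrite ?andbF ?andbT.
  - rewrite !inE -val_eqE /= sgn; case: ltngtP; rewrite ?andbF //= => _ _.
    by rewrite exprS mulN1r mulNr !mulrN /F; congr (- (_ * _)); rewrite mulrCA.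
rewrite (eq_bigr _ term) sumrB; apply/eqP; rewrite subr_eq0; apply/eqP.
rewrite (exchange_big_dep (fun j => j \notin T)) /=; last by move=> j k _ /andP[].
apply: eq_bigr => k kT; apply: eq_big => [j|j _]; last exact: FC.
by rewrite kT.
Qed.

Lemma koszul_diff0 : koszul_diff (0 : chain) = 0.
Proof.
apply/ffunP => T; rewrite !ffunE big1 // => j _.
by rewrite ffunE !mulr0.
Qed.

Lemma koszul_diffB f g : koszul_diff (f - g) = koszul_diff f - koszul_diff g.
Proof.
apply/ffunP => T; rewrite !ffunE -sumrB; apply: eq_bigr => j _.
by rewrite !ffunE !mulrBr.
Qed.

Lemma koszul_diff_homogeneous nu f :
  koszul_homogeneous nu f -> koszul_homogeneous nu (koszul_diff f).
Proof.
move=> hf T m; rewrite ffunE => /msupp_sum_le/flattenP[r /mapP[j]].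
rewrite mem_filter => /andP[jT _] -> {r}.
rewrite -signr_odd mulr_sign => mj i.
have : m \in msupp ('X_j * f (j |: T)%SET).
  by move: mj; case: odd => //; rewrite (perm_mem (msuppN _)).
rewrite mulrC (perm_mem (msuppMX _ _)) => /mapP[m' /hf/(_ i) -> ->].
rewrite mnmDE mnm1E !inE [i == j]eq_sym.
by case: eqVneq => [<-|_]; rewrite ?(negPf jT) /= ?addn0 ?add0n // addnC.
Qed.

(** The chain p x_1 ^ ... ^ x_n of homological degree n. *)
Definition top_chain (p : R) : chain :=
  [ffun S => if S == [set: 'I_n]%SET then p else 0].

Lemma top_chainE f : (forall S, #|S| != n -> f S = 0) ->
  f = top_chain (f [set: 'I_n]%SET).
Proof.
move=> f0; apply/ffunP => S; rewrite ffunE; case: eqP => [->//|SnT].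
apply: f0; apply/eqP => cS; apply: SnT; apply/eqP.
by rewrite eqEcard finset.subsetT cardsT card_ord cS /=.
Qed.

Lemma top_chain0 : top_chain 0 = 0.
Proof. by apply/ffunP => S; rewrite !ffunE if_same. Qed.

Lemma card_pred_setC1P S : (0 < n)%N -> #|S| = n.-1 -> exists j, S = (~: [set j])%SET.
Proof.
move=> n_gt0 cS; have := cardsC S; rewrite card_ord cS => e.
have /eqP/cards1P[j Sj] : #|(~: S)%SET| = 1%N by lia.
by exists j; rewrite -Sj finset.setCK.
Qed.

Lemma card_setC1 (j : 'I_n) : #|(~: [set j])%SET| = n.-1.
Proof. by have := cardsC1 j; rewrite card_ord. Qed.

Lemma card_setU1_full S j : j \notin S -> (j |: S)%SET = [set: 'I_n]%SET ->
  #|S| = n.-1.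
Proof.
by move=> jS e; have := cardsU1 j S; rewrite e cardsT card_ord jS; lia.
Qed.

Lemma koszul_diff_top p (j : 'I_n) : koszul_diff (top_chain p) (~: [set j])%SET =
  (-1) ^+ #|[pred t in (~: [set j])%SET | (t < j)%N]| * ('X_j * p).
Proof.
rewrite ffunE (big_pred1 j) => [|k]; last by rewrite !inE negbK.
rewrite ffunE; case: eqP => // -[]; apply/finset.setP => i.
by rewrite !inE orbN.
Qed.

Lemma mpolyX_mul_eq0 (j : 'I_n) (p : R) : 'X_j * p = 0 -> p = 0.
Proof.
move=> e; apply/mpolyP => m; rewrite mcoeff0.
by rewrite -(mcoeffMX p U_(j)%MM) mulrC e mcoeff0.
Qed.

Lemma koszul_diff_top_chain J p :
  (0 < n)%N -> is_ideal J -> (forall j : 'I_n, J ('X_j * p)) ->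
  koszul_chain J n.-1 (koszul_diff (top_chain p)).
Proof.
move=> n_gt0 [J0 JD JM] Jp S; case: eqP => [cS|cS].
  have [j ->] := card_pred_setC1P n_gt0 cS.
  by rewrite koszul_diff_top; apply: JM.
rewrite ffunE big1 // => j jS; rewrite ffunE; case: eqP; rewrite ?mulr0 //.
by move=> /(card_setU1_full jS).
Qed.

(** At the complement of {j, j0}, the cycle equation has just two terms
    and reads x_j z_j0 = +- x_j0 z_j, where z_i is the component of z at the
    complement of {i}. *)
Lemma koszul_cycle_rigid z (j0 : 'I_n) :
  (forall S, #|S| != n.-1 -> z S = 0) -> koszul_diff z = 0 ->
  z (~: [set j0])%SET = 0 -> z = 0.
Proof.
move=> zS dz z0; apply/ffunP => S; rewrite [RHS]ffunE.
have [cS|/zS//] := eqVneq #|S| n.-1.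
have [|j ->] := card_pred_setC1P _ cS; first exact: leq_ltn_trans (ltn_ord j0).
have [->//|ne] := eqVneq j j0.
have := congr1 (fun f : chain => f (~: [set j; j0])%SET) dz.
rewrite !ffunE (bigD1 j0) /=; last by rewrite !inE eqxx orbT.
have U_j0 : (j0 |: ~: [set j; j0])%SET = (~: [set j])%SET.
  apply/finset.setP => i; rewrite !inE.
  by have [->|] := eqVneq i j0; rewrite ?orbF //= eq_sym ne.
have U_j : (j |: ~: [set j; j0])%SET = (~: [set j0])%SET.
  apply/finset.setP => i; rewrite !inE.
  by have [->|] := eqVneq i j; rewrite //= ne.
rewrite big1 ?addr0 => [|k]; last first.
  rewrite !inE negbK => /andP[/orP[/eqP->|/eqP->]]; last by rewrite eqxx.
  by rewrite U_j z0 !mulr0.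
by rewrite U_j0 -signr_odd mulr_sign => e; apply: (@mpolyX_mul_eq0 j0);
   move: e; case: odd => // /eqP; rewrite oppr_eq0 => /eqP.
Qed.

Lemma single_monomial (p : R) m :
  (forall k, k \in msupp p -> k = m) -> p = p@_m *: 'X_[m].
Proof.
move=> pm; apply/mpolyP => k; rewrite mcoeffZ mcoeffX.
have [<-|ne] := eqVneq m k; first by rewrite mulr1.
rewrite mulr0; apply: memN_msupp_eq0; apply/negP => /pm e.
by rewrite e eqxx in ne.
Qed.

Definition mnm_succ (s : 'X_{1..n}) : 'X_{1..n} := [multinom (s i).+1 | i < n].

Lemma top_chain_homogeneous s (c : K) :
  koszul_homogeneous (mnm_succ s) (top_chain (c *: 'X_[s])).
Proof.
move=> S m; rewrite ffunE; case: eqP => [-> |_]; last by rewrite msupp0.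
by move=> /msuppZ_le; rewrite msuppX inE => /eqP-> j; rewrite mnmE inE addn1.
Qed.

Lemma koszul_chain_top (J : set R) g : (0 < n)%N -> koszul_chain J n.-1.+1 g ->
  g = top_chain (g [set: 'I_n]%SET) /\ J (g [set: 'I_n]%SET).
Proof.
move=> n_gt0; rewrite prednK // => Jg; split.
  by apply: top_chainE => S nS; have := Jg S; rewrite (negPf nS).
by have := Jg [set: 'I_n]%SET; rewrite cardsT card_ord eqxx.
Qed.

Lemma top_chain_koszul_chain (J : set R) p :
  (0 < n)%N -> J p -> koszul_chain J n.-1.+1 (top_chain p).
Proof.
move=> n_gt0 Jp S; rewrite prednK // ffunE.
case: eqP => cS; case: eqP => ST //; last by case: cS; rewrite ST cardsT card_ord.
by case: ST; apply/eqP; rewrite eqEcard finset.subsetT cardsT card_ord cS /=.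
Qed.

Lemma koszul_diff_top_eq0 p : (0 < n)%N -> koszul_diff (top_chain p) = 0 -> p = 0.
Proof.
move=> n_gt0 /(congr1 (fun f : chain => f (~: [set Ordinal n_gt0])%SET)).
rewrite koszul_diff_top ffunE => /eqP; rewrite mulf_eq0 signr_eq0 /= => /eqP.
exact: mpolyX_mul_eq0.
Qed.

(** The differential of x^s x_1 ^ ... ^ x_n is a cycle of the complex of V; the
    only chain of degree n that could bound it is x^s x_1 ^ ... ^ x_n, whose
    coefficient lies outside the ideal. *)
Lemma corner_koszul_homology (V : set 'X_{1..n}) s : (0 < n)%N ->
  up_closed V -> corner V s ->
  koszul_homology_neq0 (monomial_span (K := K) V) n.-1 (mnm_succ s).
Proof.
move=> n_gt0 upV [Vs sV]; exists (koszul_diff (top_chain 'X_[s])).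
  split; last exact: koszul_diff_sq0.
    apply: koszul_diff_top_chain => // [|j]; first exact: monomial_span_ideal.
    by rewrite -mpolyXD; apply/monomial_span_X; rewrite addmC.
  apply: koszul_diff_homogeneous; rewrite -['X_[s]]scale1r.
  exact: top_chain_homogeneous.
move=> [g [/(koszul_chain_top n_gt0)[gE Jg] hg] /= e].
have g0 : g [set: 'I_n]%SET = 0.
  apply: msuppnil0; case eg : (msupp _) => [//|m r].
  have mg : m \in msupp (g [set: 'I_n]%SET) by rewrite eg mem_head.
  case: Vs; suff -> : s = m by apply: Jg.
  by apply/mnmP => j; have := hg _ _ mg j; rewrite mnmE inE addn1 => -[].
have /mpolyP/(_ s)/eqP : 'X_[s] = 0 :> R.
  by apply: koszul_diff_top_eq0 => //; rewrite -e gE g0 top_chain0 koszul_diff0.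
by rewrite mcoeffX eqxx mcoeff0 oner_eq0.
Qed.

(** If nu_i = 0 then every component of a cycle at a set containing i vanishes.
    By rigidity this kills the cycle as soon as n > 1; for n = 1 the component
    left over is a constant in a proper ideal. *)
Lemma koszul_cycle_multidegree_gt0 (V : set 'X_{1..n}) nu z :
  ~ V 0%MM -> koszul_cycles (monomial_span (K := K) V) n.-1 nu z -> z <> 0 ->
  forall i, (0 < nu i)%N.
Proof.
move=> V0 [Jz hz dz] z_neq0 i; rewrite lt0n; apply/eqP => nui0; apply: z_neq0.
have zS S : #|S| != n.-1 -> z S = 0 by move=> nS; have := Jz S; rewrite (negPf nS).
have z0 S : i \in S -> z S = 0.
  move=> iS; apply: msuppnil0; case e : (msupp _) => [//|m r].
  have /hz/(_ i) : m \in msupp (z S) by rewrite e mem_head.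
  by rewrite nui0 iS addn1.
have [[j /eqP ne]|/forallNP alli] := pselect (exists j, j <> i).
  by apply: (koszul_cycle_rigid (j0 := j)) => //; apply: z0; rewrite !inE eq_sym.
apply: (koszul_cycle_rigid (j0 := i)) => //.
apply: msuppnil0; case e : (msupp _) => [//|m r].
have mz : m \in msupp (z (~: [set i])%SET) by rewrite e mem_head.
have := Jz (~: [set i])%SET; rewrite card_setC1 eqxx => /(_ m mz).
suff -> : m = 0%MM by [].
apply/mnmP => k; rewrite mnm0E; have -> : k = i by apply: contrapT; apply: alli.
by have := hz _ _ mz i; rewrite nui0 !inE eqxx addn0.
Qed.

(** Exactness of the Koszul complex of the full polynomial ring at the
    penultimate spot: choose c so that both sides agree in one component. *)
Lemma koszul_cycle_top_boundary (z : chain) (s : 'X_{1..n}) : (0 < n)%N ->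
  (forall S, #|S| != n.-1 -> z S = 0) -> koszul_homogeneous (mnm_succ s) z ->
  koszul_diff z = 0 ->
  exists c, z = koszul_diff (top_chain (c *: 'X_[s])).
Proof.
move=> n_gt0 zS hz dz; pose j0 := Ordinal n_gt0.
pose sg : bool := odd #|[pred t in (~: [set j0])%SET | (t < j0)%N]|.
have zC : z (~: [set j0])%SET =
    (z (~: [set j0])%SET)@_(U_(j0) + s)%MM *: ('X_j0 * 'X_[s]).
  rewrite -mpolyXD; apply: single_monomial => m mz; apply/mnmP => i.
  have := hz _ _ mz i; rewrite mnmDE !mnmE !inE [i == j0]eq_sym.
  by case: (j0 == i) => /=; lia.
(* The sign of the component at j0 in the differential of a top chain is its
   own inverse, so the same sign makes c x^s reproduce that component of z. *)
pose c := (-1) ^+ sg * (z (~: [set j0])%SET)@_(U_(j0) + s)%MM.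
exists c; apply/eqP; rewrite -subr_eq0; apply/eqP.
apply: (koszul_cycle_rigid (j0 := j0)).
- move=> S nS; rewrite !ffunE zS // big1 ?subr0 // => j jS.
  rewrite ffunE; case: eqP; rewrite ?mulr0 // => e.
  by rewrite (card_setU1_full jS e) eqxx in nS.
- by rewrite koszul_diffB dz koszul_diff_sq0 subr0.
- rewrite 2!ffunE koszul_diff_top -signr_odd -/sg {1}zC /c.
  rewrite !mulr_sign.
  by case: (sg); rewrite ?scaleNr ?mulrN ?opprK -scalerAr ?subrr.
Qed.

Lemma koszul_homology_corner (V : set 'X_{1..n}) nu : (0 < n)%N ->
  up_closed V -> ~ V 0%MM ->
  koszul_homology_neq0 (monomial_span (K := K) V) n.-1 nu ->
  exists2 s, corner V s & mnm_succ s = nu.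
Proof.
move=> n_gt0 upV V0 [z zcyc nbz]; have [Jz hz dz] := zcyc.
have [J0 _ JM] := monomial_span_ideal (K := K) upV.
have z_neq0 : z <> 0.
  move=> z0; apply: nbz; exists (top_chain 0).
    split; first exact: top_chain_koszul_chain.
    by rewrite top_chain0 => S m; rewrite ffunE msupp0.
  by rewrite top_chain0 koszul_diff0.
have zS S : #|S| != n.-1 -> z S = 0 by move=> nS; have := Jz S; rewrite (negPf nS).
pose s := mnm_prime nu.
have nuE : nu = mnm_succ s.
  apply/mnmP => i; rewrite !mnmE prednK //.
  exact: koszul_cycle_multidegree_gt0 zcyc z_neq0 i.
have [|c zE] := koszul_cycle_top_boundary (s := s) n_gt0 zS _ dz.
  by rewrite -nuE.
have c_neq0 : c != 0.
  by apply/eqP => c0; apply: z_neq0; rewrite zE c0 scale0r top_chain0 koszul_diff0.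
exists s => //; split=> [Vs|i].
  apply: nbz; exists (top_chain (c *: 'X_[s])) => //; split.
    apply: top_chain_koszul_chain => //; rewrite -mul_mpolyC; apply: JM.
    exact/monomial_span_X.
  by rewrite nuE; apply: top_chain_homogeneous.
have := Jz (~: [set i])%SET; rewrite card_setC1 eqxx; apply.
rewrite zE koszul_diff_top -signr_odd mulr_sign -scalerAr -mpolyXD addmC.
have mX : (U_(i) + s)%MM \in msupp (c *: 'X_[U_(i) + s] : R).
  by rewrite msuppMCX // inE.
by case: odd; rewrite // (perm_mem (msuppN _)).
Qed.

Lemma koszul_multidegrees_corner (V : set 'X_{1..n}) : (0 < n)%N ->
  up_closed V -> ~ V 0%MM ->
  koszul_multidegrees (monomial_span (K := K) V) n.-1 =
    [set mnm_succ s | s in corner V].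
Proof.
move=> n_gt0 upV V0; apply/seteqP; split=> nu.
  exact: koszul_homology_corner.
by move=> [s cs <-]; apply: corner_koszul_homology.
Qed.

End Koszul.

(** * The irreducible decomposition *)
Section Decomposition.
Context {n : nat} {K : fieldType}.
Local Open Scope classical_set_scope.
Local Open Scope ring_scope.

Lemma mnm_succK (s : 'X_{1..n}) : mnm_prime (mnm_succ s) = s.
Proof. by apply/mnmP => i; rewrite !mnmE. Qed.

(** Only singletons matter for [underline], since a subset of a cone of true
    free directions is again one; {x_i} is such a cone exactly when s_i has
    reached l_i, for s a corner. *)
Lemma mpow_underline (U : set 'X_{1..n}) (l s : 'X_{1..n}) :
  up_closed U -> exponent_lcm U l -> corner (U `|` exceeds l) s ->
  mpow (underline (monomial_span (K := K) U) (mnm_succ s)) =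
    monomial_span (component l s) :> set {mpoly K[n]}.
Proof.
move=> upU lcml cs; have [/not_orP[nUs /forallNP nls] sV] := cs.
have free i : (exists C : {set 'I_n},
    true_free_cone (monomial_span (K := K) U) (mnm_succ s) C /\ i \in C) <->
    (l i <= s i)%N.
  split=> [[C [freeC iC]]|lsi].
    rewrite leqNgt; apply/negP => ltsi; apply: (freeC U_(i)%MM) => [j jC|].
      by rewrite mnm1E; case: eqVneq => // ij; rewrite -ij iC in jC.
    rewrite mnm_succK -mpolyXD; apply/monomial_span_X.
    case: (sV i) => // -[j]; rewrite mnmDE mnm1E.
    case: eqVneq => [<-|_]; first by rewrite addn1 ltnS leqNgt ltsi.
    by rewrite addn0 => ltj; case: (nls j).
  exists [set i]%SET; split=> [t t0|]; last by rewrite inE.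
  rewrite mnm_succK -mpolyXD => /monomial_span_X Ust.
  have [g gmin leg] := minimal_exponent_below Ust; apply: nUs.
  apply: upU (gmin.1) _; apply/mnm_lepP => j.
  have [->|ne] := eqVneq j i.
    by apply: leq_trans lsi; apply: (mnm_lepP (lcml.1 _ gmin)).
  by have := mnm_lepP leg j; rewrite mnmDE t0 ?inE // addn0.
have underlineE i : underline (monomial_span (K := K) U) (mnm_succ s) i =
    if (l i <= s i)%N then 0%N else (s i).+1.
  rewrite !mnmE; case: asboolP => h; case: leqP => // lts.
    by move/free: h; rewrite leqNgt lts.
  by case: h; apply/free.
rewrite mpow_span; congr monomial_span; apply/seteqP.
by split=> m [i mi]; exists i; move: mi; rewrite /= underlineE; case: (leqP (l i) (s i)).
Qed.

End Decomposition.

Theorem proposition2p3p6 (n : nat) (K : fieldType) (charK0 : [pchar K]%R =i pred0)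
    (I : set {mpoly K[n]}) (monoI : monomial_ideal I) :
  irredundant_irreducible_decomposition I
    (koszul_multidegrees (artinian_closure I) n.-1)
    (underline I).
Proof.
have [U [upU -> U0 [m0 Um0]]] := monomial_ideal_span monoI.
have [l lcml] := exponent_lcm_exists U.
have n_gt0 : (0 < n)%N.
  rewrite lt0n; apply/eqP => n0; apply: U0.
  by apply: upU Um0 _; apply/mnm_lepP => i; have := ltn_ord i; rewrite {2}n0.
rewrite (artinian_closure_span upU lcml) koszul_multidegrees_corner //; last 2 first.
- exact: up_closed_exceeds.
- by case=> // -[i]; rewrite mnm0E.
split.
- exact/finite_image/finite_corners.
- apply/seteqP; split=> [p Up _ [s cs <-]|p Up m mp].
    rewrite (mpow_underline upU lcml cs) => m /Up Um.
    exact: ((up_closed_components m upU lcml).1 Um).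
  apply/(up_closed_components m upU lcml) => s cs.
  have := Up (mnm_succ s) (ex_intro2 _ _ s cs erefl).
  by rewrite (mpow_underline upU lcml cs) => /(_ m mp).
- move=> _ [s cs <-] e; case: (cs) => -[]; left.
  apply/(monomial_span_X (K := K)); rewrite e => _ [[t ct <-] ne].
  rewrite (mpow_underline upU lcml ct); apply/monomial_span_X.
  by apply: (component_other upU cs ct) => ts; apply: ne; rewrite ts.
Qed.
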